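(* Let $0<\lambda<1$ and $a>0$, and consider the map $f:\mathbb{R}^2\to\mathbb{R}^2$, $$f(x,y)=\big(x+y+g(x),\ \lambda(y+g(x))\big),\qquad g(x)=\begin{cases}a(x+1),&x<0,\\ a(x-1),&x\ge0.\end{cases}$$ If $a\le 1-\lambda$, then $f$ has a singular hyperbolic attractor (the Belykh attractor).
   Context: ''$f$ has a singular hyperbolic attractor'' means: there is a nonempty bounded region $P\subset\mathbb{R}^2$ with $f(P)\subset P$, giving the attractor $\mathcal{A}=\bigcap_{k\ge1}f^k(P)$, and $f$ is uniformly hyperbolic off the discontinuity line $\{x=0\}$, in the sense that there are two fixed transversal directions (the eigendirections of the constant linearization matrix $A=\begin{pmatrix}1+a&1\\ \lambda a&\lambda\end{pmatrix}$), with $A$ expanding by a factor $\mu_1>1$ along one of them and contracting by a factor $0<\mu_2<1$ along the other, so that orbits of $\mathcal{A}$ have Lyapunov exponents $\ln\mu_1>0$ and $\ln\mu_2<0$. The word ''singular'' refers to the discontinuity line $\{x=0\}$, which the attractor may intersect. *)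

(* Defs.v *)
From mathcomp Require Import all_boot all_order all_algebra.
From mathcomp Require Import all_classical all_reals all_analysis.

Set Implicit Arguments.
Unset Strict Implicit.
Unset Printing Implicit Defensive.

Import Order.TTheory GRing.Theory Num.Theory.
Import numFieldNormedType.Exports.

Local Open Scope classical_set_scope.
Local Open Scope ring_scope.

(* The plane is 'cV[R]_2: the point (x, y) is the column vector with
   entries x = p 0 0 and y = p 1 0. *)

Definition belykh_g (R : realType) (a x : R) : R :=
  if x < 0 then a * (x + 1) else a * (x - 1).

Definition belykh (R : realType) (a lambda : R) (p : 'cV[R]_2) : 'cV[R]_2 :=
  let x := p 0 0 in
  let y := p 1 0 in
  \col_(i < 2) if i == 0 then x + y + belykh_g a x
               else lambda * (y + belykh_g a x).

Definition belykh_matrix (R : realType) (a lambda : R) : 'M[R]_2 :=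
  \matrix_(i < 2, j < 2)
    if i == 0 then (if j == 0 then 1 + a else 1)
    else (if j == 0 then lambda * a else lambda).

Definition vertical_axis (R : realType) : set 'cV[R]_2 := [set p | p 0 0 = 0].

(* A nonempty connected open set together with some (possibly none, possibly
   all) of its boundary points.  A single fixed point, for instance, is
   invariant but is not a region. *)
Definition region (R : realType) (P : set 'cV[R]_2) : Prop :=
  [/\ P° !=set0, connected P° & P `<=` closure P°].

Definition attractor (R : realType) (f : 'cV[R]_2 -> 'cV[R]_2)
    (P : set 'cV[R]_2) : set 'cV[R]_2 :=
  \bigcap_(k in [set k | (1 <= k)%N]) (iter k f @` P).

(* The limit does not depend on the norm chosen on the plane.  When iter n f
   is not differentiable at p, 'd (iter n f) p is unspecified, so this is only
   meant for orbits along which f is differentiable. *)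
Definition lyapunov_exponent (R : realType) (f : 'cV[R]_2 -> 'cV[R]_2)
    (p v : 'cV[R]_2) (l : R) : Prop :=
  (fun n : nat => ln `|'d (iter n f) p v| / n%:R) @ \oo --> l.

(* S is the discontinuity set of f and A its constant linearization off S.
   Lyapunov exponents are required at the points of the attractor whose forward
   orbit avoids S, the only ones at which all iterates can be differentiated. *)
Definition has_singular_hyperbolic_attractor (R : realType)
    (f : 'cV[R]_2 -> 'cV[R]_2) (S : set 'cV[R]_2) (A : 'M[R]_2) : Prop :=
  exists (P : set 'cV[R]_2) (v1 v2 : 'cV[R]_2) (mu1 mu2 : R),
    [/\ [/\ region P, bounded_set P, f @` P `<=` P & attractor f P !=set0],
        [/\ forall p, S p -> ~ {for p, continuous f},
            forall p, ~ S p -> differentiable f p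
          & forall p, ~ S p -> forall v, 'd f p v = A *m v],
        [/\ \rank (row_mx v1 v2) = 2%N,
            1 < mu1, 0 < mu2 < 1,
            A *m v1 = mu1 *: v1 & A *m v2 = mu2 *: v2]
      & forall p, attractor f P p -> (forall n, ~ S (iter n f p)) ->
          lyapunov_exponent f p v1 (ln mu1) /\
          lyapunov_exponent f p v2 (ln mu2)].

(* Main.v *)
Require Import Defs.
From mathcomp Require Import all_boot all_order all_algebra.
From mathcomp Require Import all_classical all_reals all_analysis.
From mathcomp Require Import ring lra.
Import Order.TTheory GRing.Theory Num.Theory.
Import numFieldNormedType.Exports.

(** Write e for the sign of x (with e = 1 on the axis x = 0) and A for the
linearization matrix.  On the half-plane of sign e the map is affine with
linear part A and fixed point (e, 0).  The characteristic polynomial of A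
takes the value lambda at 0, -a * lambda at lambda and -a at 1, so A has
eigenvalues 0 < mu2 < lambda and 1 < mu1, and mu1 * mu2 = lambda.

In the coordinates u_i = x + y / (mu_i - lambda), given by the left
eigenvectors of A scaled to be 1 at (1, 0), the map becomes diagonal:
u_i - e is multiplied by mu_i ([adapted_coord_belykh]).  The trapping region
is the parallelogram |u_1| <= 1, |u_2| <= 1.  In the contracting coordinate
invariance is clear.  In the expanding one, take e = 1 by symmetry: the new
value of u_1 stays below 1, and it stays above -1 as soon as
mu1 * (1 - u_1) <= 2.  Since x is the convex combination of u_1 and u_2 with
weights proportional to mu1 - lambda and lambda - mu2, the condition x >= 0
prevents u_1 from being too small, and the worst case is
mu1 * (mu1 - mu2) <= 2 * (mu1 - lambda), which is the inequality
a <= 1 - lambda ([belykh_gauge_ball_invariant]).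

The parallelogram is the unit ball of a continuous homogeneous function,
hence a region ([region_unit_gauge_ball]), and it contains the fixed point
(1, 0), so the attractor is nonempty.  Off the axis the differential of the
map is A, hence that of the n-th iterate is A^n along orbits avoiding the
axis, and an eigenvector with eigenvalue mu has Lyapunov exponent ln mu
([lyapunov_exponent_eigenvector]). *)

Set Implicit Arguments.
Unset Strict Implicit.
Unset Printing Implicit Defensive.
Local Open Scope classical_set_scope.
Local Open Scope ring_scope.

(** * Vectors and matrices in dimension two *)

Lemma cV2E (R : realType) (p : 'cV[R]_2) :
  p = p 0 0 *: delta_mx 0 0 + p 1 0 *: delta_mx 1 0.
Proof.
apply/colP => i; rewrite !mxE eqxx !andbT.
by case: i => -[|[|//]] i2 /=; rewrite ?mulr0 ?mulr1 ?addr0 ?add0r; congr (p _ _);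
  apply: val_inj.
Qed.

Lemma rank_row_mx2 (F : fieldType) (u v : 'cV[F]_2) :
  u 0 0 * v 1 0 != v 0 0 * u 1 0 -> \rank (row_mx u v) = 2%N.
Proof.
move=> uv; apply: (@mxrank_unit F 2); rewrite unitmxE unitfE.
rewrite (expand_det_row _ 0) !big_ord_recl big_ord0 /cofactor !det_mx11 !mxE.
case: splitP => // j0 _; case: splitP => // [j1 /= E|j1 _].
  by move: (ltn_ord j1); rewrite -E.
case: splitP => // j2 _; rewrite !ord1 /=.
rewrite (_ : lift 0 0 = 1); last exact: val_inj.
by rewrite expr0 expr1 mul1r mulN1r mulrN addr0 subr_eq0.
Qed.

Lemma mulmx2_continuous (R : realType) (A : 'M[R]_2) :
  continuous (mulmx A : 'cV[R]_2 -> 'cV[R]_2).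
Proof.
have -> : (mulmx A : 'cV[R]_2 -> 'cV[R]_2) =
    (fun p => p 0 0 *: (A *m delta_mx 0 0) + p 1 0 *: (A *m delta_mx 1 0)).
  by apply/funext => p; rewrite {1}(cV2E p) mulmxDr !scalemxAr.
move=> p; apply: (@cvgD _ _ _ (nbhs (p : 'cV[R]_2)));
  apply: (@cvgZr_tmp _ _ _ (nbhs (p : 'cV[R]_2))); exact: coord_continuous.
Qed.

(** * Differential calculus *)

(** The remainder in the expansion of f at x vanishes identically near x, which
is a special case of being negligible. *)
Lemma is_diff_locally_affine (R : numFieldType) (V W : normedModType R)
    (f : V -> W) (df : {linear V -> W}) (x : V) :
  continuous df -> (\forall y \near x, f y = f x + df (y - x)) ->
  is_diff x f df.
Proof.
move=> dfc fdf.
have expand : f \o shift x = cst (f x) + df +o_ 0 id.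
  apply/eqaddoP => e e0; near=> h.
  have fE : f (h + x) = f x + df (h + x - x).
    by near: h; move: fdf; rewrite (near_shift 0) /= subr0.
  suff -> : (f \o shift x - (cst (f x) + df)) h = 0.
    by rewrite normr0; apply: mulr_ge0; [exact: ltW | exact: normr_ge0].
  rewrite [LHS](_ : _ = f (h + x) - (f x + df h))//.
  by rewrite fE addrK subrr.
have dE : 'd f x = df :> (V -> W) by exact: diff_unique.
by apply: DiffDef => //; apply/diff_locallyP; rewrite dE.
Unshelve. all: by end_near. Qed.

(** Along an eigenvector the n-th differential multiplies norms by mu ^+ n, so
the logarithm divided by n is ln mu + ln |v| / n. *)
Lemma lyapunov_exponent_eigenvector (R : realType)
    (f : 'cV[R]_2 -> 'cV[R]_2) (A : 'M[R]_2) (p v : 'cV[R]_2) (mu : R) :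
  (forall n, is_diff p (iter n f) (iter n (mulmx A))) ->
  A *m v = mu *: v -> 0 < mu -> v != 0 ->
  lyapunov_exponent f p v (ln mu).
Proof.
move=> df Av mu0 v0.
have iterAv n : iter n (mulmx A) v = mu ^+ n *: v.
  elim: n => [|n IH]; first by rewrite expr0 scale1r.
  by rewrite iterS IH -scalemxAr Av scalerA exprSr.
rewrite /lyapunov_exponent -cvg_shiftS /=.
have lnE n : ln `|'d (iter n.+1 f) p v| / n.+1%:R =
    ln mu + ln `|v| * harmonic n.
  have dfn := df n.+1; rewrite diff_val iterAv normrZ.
  rewrite ger0_norm ?exprn_ge0 ?ltW// lnM ?posrE ?exprn_gt0 ?normr_gt0//.
  by rewrite lnXn// /harmonic mulrDl -(mulr_natr (ln mu)) mulfK// pnatr_eq0.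
suff : ln mu + ln `|v| * harmonic n @[n --> \oo] --> ln mu + ln `|v| * 0.
  rewrite mulr0 addr0; apply: cvg_trans.
  by apply: near_eq_cvg; apply: nearW => n; rewrite lnE.
by apply: cvgD; [exact: cvg_cst | apply: cvgMl_tmp; exact: cvg_harmonic].
Qed.

(** * Unit balls of homogeneous functions *)

(** The interior of the ball is the open ball: a point p of the interior can be
pushed outwards to t p, with t > 1, without leaving the ball, so that
t * N p <= 1.  The open ball is star-shaped at 0, hence connected, and shrinking
a point of the closed ball moves it into the open one. *)
Lemma region_unit_gauge_ball (R : realType) (N : 'cV[R]_2 -> R) :
  continuous N -> (forall t p, N (t *: p) = `|t| * N p) ->
  region [set p | N p <= 1].
Proof.
move=> Nc Nh; set P := [set p | _]; set Q := [set p | N p < 1].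
have N0 : N 0 = 0 by rewrite -(scale0r 0) Nh normr0 mul0r.
have scale_continuous (p : 'cV[R]_2) : continuous (fun t : R => t *: p).
  by move=> t; apply: cvgZr_tmp; exact: cvg_id.
have intP : P° = Q.
  rewrite eqEsubset; split.
    move=> p Pp.
    have /nbhs_ballP[e /= e0 Pe] : \forall t \near (1 : R), P (t *: p).
      by apply: (scale_continuous p 1); rewrite /= scale1r.
    (* Any factor in the interval ]1, 1 + e[ would do. *)
    have : P ((1 + e / 2) *: p).
      apply: Pe; rewrite /ball /= opprD addrA subrr sub0r normrN ger0_norm; lra.
    rewrite /P /Q /= Nh ger0_norm; last by lra.
    by move=> Np; rewrite ltNge; apply/negP => Np1; nra.
  rewrite -open_subsetE; first by move=> p /ltW.
  apply: (@open_comp _ _ N [set x | x < 1]) => [p _|]; first exact: Nc.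
  exact: open_lt.
rewrite /region intP; split.
- by exists 0; rewrite /Q /= N0.
- have -> : Q = \bigcup_(p in Q) ((fun t : R => t *: p) @` `[0, 1]).
    rewrite eqEsubset; split=> [p Qp|q [p Qp [t /= /andP[]]]].
      by exists p => //; exists 1; rewrite ?scale1r//= in_itv/= ler01 lexx.
    rewrite !bnd_simp => t0 t1 <-; rewrite /Q /= Nh ger0_norm//.
    by move: (Qp : N p < 1) => ?; case: (lerP 0 (N p)) => ?; nra.
  apply: bigcup_connected.
    exists 0 => p _; exists 0; rewrite ?scale0r//= in_itv/= ler01 lexx//.
  move=> p _; apply: connected_continuous_connected; first exact: segment_connected.
  by apply: continuous_subspaceT.
- move=> p Pp B; rewrite -[p in nbhs p]scale1r.
  move=> /(scale_continuous p 1) /nbhs_ballP[e /= e0 Be].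
  have e1 : 0 < (1 + e)^-1 < 1 by rewrite invr_gt0 invf_lt1; lra.
  (* The factor (1 + e)^-1 is less than 1 and at distance less than e from 1,
     whatever the size of e. *)
  exists ((1 + e)^-1 *: p); split.
    by move: Pp; rewrite /Q /P /= Nh gtr0_norm; nra.
  apply: Be; rewrite /ball /= ger0_norm; last lra.
  have -> : 1 - (1 + e)^-1 = e * (1 + e)^-1 by field; lra.
  nra.
Qed.

(** * The Belykh map off and on the discontinuity line *)

Section BelykhMap.
Variables (R : realType) (a lambda : R).
Implicit Types (p q v : 'cV[R]_2) (mu : R).

Lemma belykhE p : belykh a lambda p = belykh_matrix a lambda *m p +
  (if p 0 0 < 0 then 1 else -1) *: (\col_(i < 2) if i == 0 then a else lambda * a).
Proof.
apply/colP => i; rewrite !mxE !big_ord_recl big_ord0 !mxE /belykh_g /=.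
rewrite (_ : lift ord0 ord0 = 1); last exact: val_inj.
by case: ifP => _; case: ifP => _; ring.
Qed.

(** Near a point off the axis the sign of x is constant, so only one of the two
affine branches is seen. *)
Lemma is_diff_belykh p : ~ vertical_axis p ->
  is_diff p (belykh a lambda) (mulmx (belykh_matrix a lambda)).
Proof.
move=> /eqP p0.
have side : \forall q \near p, ((q : 'cV[R]_2) 0 0 < 0) = (p 0 0 < 0).
  have pc := @coord_continuous R 2 1 0 0 p.
  case: (ltrP (p 0 0) 0) => [plt0|pge0]; first exact: (cvgr_lt _ pc).
  have pgt0 : 0 < p 0 0 by rewrite lt_def p0.
  by near=> q; apply/negbTE; rewrite -leNgt; near: q; exact: (cvgr_ge _ pc).
have aff (q : 'cV[R]_2) : (q 0 0 < 0) = (p 0 0 < 0) -> belykh a lambda q =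
    belykh a lambda p + belykh_matrix a lambda *m (q - p).
  by move=> sgn; rewrite !belykhE sgn mulmxBr addrAC subrKC.
apply: (is_diff_locally_affine (df := mulmx (belykh_matrix a lambda))).
  exact: mulmx2_continuous.
apply: filterS side => q; exact: aff.
Unshelve. all: by end_near. Qed.

Lemma is_diff_iter_belykh p :
  (forall n, ~ vertical_axis (iter n (belykh a lambda) p)) -> forall n,
  is_diff p (iter n (belykh a lambda)) (iter n (mulmx (belykh_matrix a lambda))).
Proof.
move=> offS; elim=> [|n IH]; first exact: is_diff_id.
exact: (is_diff_comp IH (is_diff_belykh (offS n))).
Qed.

(** Crossing the axis makes g jump from a to -a; the second coordinate, where x
enters only through g, shows the jump lambda * 2 a. *)
Lemma belykh_discontinuous p : 0 < lambda -> 0 < a -> vertical_axis p ->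
  ~ {for p, continuous (belykh a lambda)}.
Proof.
move=> l0 a0 /= px0 fc.
pose h t := (belykh a lambda (p - t *: delta_mx 0 0)) 1 0.
have hE t : h t = lambda * (p 1 0 + if 0 < t then a * (1 - t) else - a * (t + 1)).
  rewrite /h /belykh /belykh_g !mxE /= px0 sub0r mulr1 mulr0 subr0 oppr_lt0.
  by congr (_ * (_ + _)); case: ifP => _; ring.
have hc : h t @[t --> 0] --> h 0.
  apply: (@continuous_comp _ _ _
     (fun t : R => belykh a lambda (p - t *: delta_mx 0 0)) (fun q => q 1 0)).
    apply: continuous_comp; last by rewrite scale0r subr0.
    apply: continuousB; first exact: cst_continuous.
    exact: scalel_continuous.
  exact: coord_continuous.
have la0 : 0 < lambda * a by rewrite mulr_gt0.
have jump : h 0 < h 0 + lambda * a by rewrite ltrDl.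
(* For 0 < t < 1 the exact difference h t - h 0 = lambda * a * (2 - t) exceeds
   lambda * a, which contradicts continuity at 0. *)
have : \forall t \near (0 : R), h t < h 0 + lambda * a by exact: (cvgr_lt _ hc).
move=> /nbhs_ballP[e /= e0 he].
(* This t lies both below 1 and below e. *)
have t0 : 0 < e / (1 + e) by apply: divr_gt0; lra.
have t1 : e / (1 + e) < 1 by rewrite ltr_pdivrMr; lra.
have te : e / (1 + e) < e by rewrite ltr_pdivrMr; nra.
have : h (e / (1 + e)) < h 0 + lambda * a.
  by apply: he; rewrite /ball /= sub0r normrN gtr0_norm.
rewrite !hE ltxx t0; set t := e / (1 + e) in t0 t1 te *.
nra.
Qed.

(** * Eigenvalues and adapted coordinates *)

(** The characteristic equation of the linearization matrix. *)
Definition belykh_eigen mu := a * mu = (mu - 1) * (mu - lambda).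

(** The discriminant exceeds (1 - a - lambda) ^+ 2 by 4 a, which puts the larger
root above 1; the position of the smaller one then follows from the
characteristic equations and the product of the roots. *)
Lemma belykh_eigenvalues : 0 < lambda -> lambda < 1 -> 0 < a ->
  exists mu1 mu2, [/\ belykh_eigen mu1, belykh_eigen mu2, mu1 * mu2 = lambda,
                      1 < mu1 & 0 < mu2 < lambda].
Proof.
move=> l0 l1 a0; rewrite /belykh_eigen.
pose T := 1 + a + lambda; pose D := T ^+ 2 - 4 * lambda.
have D0 : 0 <= D by rewrite /D /T; nra.
have sD := sqr_sqrtr D0; set s := Num.sqrt D in sD.
have s0 : 0 <= s by exact: sqrtr_ge0.
have m12 : ((T + s) / 2) * ((T - s) / 2) = lambda.
  have -> : (T + s) / 2 * ((T - s) / 2) = (T ^+ 2 - s ^+ 2) / 4 by field.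
  by rewrite sD /D; field.
have e1 : a * ((T + s) / 2) = ((T + s) / 2 - 1) * ((T + s) / 2 - lambda).
  by move: m12; rewrite /T => m12; nra.
have e2 : a * ((T - s) / 2) = ((T - s) / 2 - 1) * ((T - s) / 2 - lambda).
  by move: m12; rewrite /T => m12; nra.
exists ((T + s) / 2), ((T - s) / 2).
have m1 : 1 < (T + s) / 2.
  have r1 : (1 - a - lambda) ^+ 2 < s ^+ 2 by rewrite sD /D /T; nra.
  have : 1 - a - lambda < s by rewrite ltNge; apply/negP => le1; nra.
  by rewrite /T; lra.
split=> //; move: m12 e2 m1.
move: ((T + s) / 2) ((T - s) / 2) => mu1 mu2 m12 e2 m1.
have mu20 : 0 < mu2 by nra.
by rewrite mu20 /=; nra.
Qed.

Lemma belykh_eigenvector mu : belykh_eigen mu ->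
  let v := \col_(i < 2) if i == 0 then 1 else mu - 1 - a in
  belykh_matrix a lambda *m v = mu *: v.
Proof.
move=> e v; apply/colP => i; rewrite !mxE !big_ord_recl big_ord0 !mxE /=.
by case: ifP => _; [ring | rewrite /belykh_eigen in e; nra].
Qed.

(** The left eigenvector of the linearization matrix for mu, scaled to take the
value 1 at the fixed point (1, 0), hence -1 at the fixed point (-1, 0). *)
Definition adapted_coord mu p : R := p 0 0 + p 1 0 / (mu - lambda).

Lemma adapted_coordZ mu t p : adapted_coord mu (t *: p) = t * adapted_coord mu p.
Proof. by rewrite /adapted_coord !mxE mulrDr mulrA. Qed.

Lemma adapted_coord_continuous mu : continuous (adapted_coord mu).
Proof.
move=> p; apply: (@cvgD _ _ _ (nbhs (p : 'cV[R]_2))); first exact: coord_continuous.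
by apply: (@cvgMr_tmp _ _ (nbhs (p : 'cV[R]_2))); exact: coord_continuous.
Qed.

(** When mu2 < lambda < mu1, the weights on the right are positive; they add up to
mu1 - mu2, so x is then a convex combination of the adapted coordinates. *)
Lemma fst_adapted_coord mu1 mu2 p : mu1 != lambda -> mu2 != lambda ->
  (mu1 - mu2) * p 0 0 = (mu1 - lambda) * adapted_coord mu1 p +
                        (lambda - mu2) * adapted_coord mu2 p.
Proof.
by move=> m1 m2; rewrite /adapted_coord; field; rewrite !subr_eq0 m1 m2.
Qed.

Lemma snd_adapted_coord mu1 mu2 p : mu1 != lambda -> mu2 != lambda ->
  (mu1 - mu2) * p 1 0 = (mu1 - lambda) * (lambda - mu2) *
     (adapted_coord mu1 p - adapted_coord mu2 p).
Proof.
by move=> m1 m2; rewrite /adapted_coord; field; rewrite !subr_eq0 m1 m2.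
Qed.

(** In this coordinate the two branches are the affine maps of slope mu that fix
1 and -1. *)
Lemma adapted_coord_belykh mu p : mu != 0 -> mu != lambda -> belykh_eigen mu ->
  adapted_coord mu (belykh a lambda p) =
    mu * adapted_coord mu p + (if p 0 0 < 0 then mu - 1 else 1 - mu).
Proof.
move=> mu0 mul e.
(* Eliminating a, rather than mu, makes the identity one of rational functions. *)
have aE : a = (mu - 1) * (mu - lambda) / mu by rewrite -e mulfK.
rewrite /adapted_coord /belykh !mxE /= /belykh_g aE.
by case: ifP => _; field; rewrite mu0 subr_eq0 mul.
Qed.

(** * The trapping parallelogram *)

Definition belykh_gauge mu1 mu2 p : R :=
  Num.max `|adapted_coord mu1 p| `|adapted_coord mu2 p|.

Lemma belykh_gauge_le mu1 mu2 p : (belykh_gauge mu1 mu2 p <= 1) =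
  (-1 <= adapted_coord mu1 p <= 1) && (-1 <= adapted_coord mu2 p <= 1).
Proof. by rewrite /belykh_gauge ge_max !ler_norml. Qed.

Lemma region_belykh_gauge_ball mu1 mu2 :
  region [set p | belykh_gauge mu1 mu2 p <= 1].
Proof.
apply: region_unit_gauge_ball => [p|t p].
  apply: (@continuous_max _ _ (fun p => `|adapted_coord mu1 p|)
    (fun p => `|adapted_coord mu2 p|));
  by apply: (@cvg_norm _ _ _ (nbhs (p : 'cV[R]_2))); exact: adapted_coord_continuous.
by rewrite /belykh_gauge !adapted_coordZ !normrM maxr_pMr.
Qed.

Lemma bounded_belykh_gauge_ball mu1 mu2 :
  0 < mu2 < lambda -> lambda < mu1 ->
  bounded_set [set p | belykh_gauge mu1 mu2 p <= 1].
Proof.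
move=> /andP[m20 m2l] lm1.
have m1 : mu1 != lambda by rewrite gt_eqF.
have m2 : mu2 != lambda by rewrite lt_eqF.
exists (`|delta_mx 0 0 : 'cV[R]_2| +
  (2 * ((mu1 - lambda) * (lambda - mu2)) / (mu1 - mu2)) *
  `|delta_mx 1 0 : 'cV[R]_2|).
split; first exact: num_real.
move=> M /ltW leM p /=; rewrite belykh_gauge_le => /andP[/andP[u1 u2] /andP[s1 s2]].
have := fst_adapted_coord p m1 m2; have := snd_adapted_coord p m1 m2.
move=> yE xE; apply: le_trans leM; rewrite {1}(cV2E p).
apply: (le_trans (ler_normD _ _)); rewrite !normrZ; apply: lerD.
  by apply: ler_piMl => //; rewrite ler_norml; apply/andP; split; nra.
apply: ler_wpM2r => //.
rewrite ler_pdivlMr ?subr_gt0; last by lra.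
have c0 : 0 <= (mu1 - lambda) * (lambda - mu2) by apply: mulr_ge0; lra.
rewrite -[X in _ * X](@ger0_norm _ (mu1 - mu2)); last by lra.
rewrite -normrM mulrC yE normrM ger0_norm// mulrC; apply: ler_wpM2r => //.
by rewrite ler_norml; lra.
Qed.

(** This is where a <= 1 - lambda enters: by the characteristic equation it gives
mu1 ^+ 2 - 2 * mu1 + lambda <= 0, which for mu1 * mu2 = lambda is the inequality
[key].  A point with x of sign e has 1 - e * u bounded by (mu1 - mu2) /
(mu1 - lambda), where u is the expanding coordinate, and [key] says that
multiplying this bound by mu1 does not exceed 2, the length of the side. *)
Lemma belykh_gauge_ball_invariant mu1 mu2 : 0 < lambda -> a <= 1 - lambda ->
  belykh_eigen mu1 -> belykh_eigen mu2 -> mu1 * mu2 = lambda -> 1 < mu1 ->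
  0 < mu2 < lambda -> lambda < 1 ->
  forall p, belykh_gauge mu1 mu2 p <= 1 ->
  belykh_gauge mu1 mu2 (belykh a lambda p) <= 1.
Proof.
move=> l0 al e1 e2 m12 m1 /andP[m20 m2l] l1 p.
have n1 : mu1 != lambda by rewrite gt_eqF; lra.
have n2 : mu2 != lambda by rewrite lt_eqF.
have z1 : mu1 != 0 by rewrite gt_eqF; lra.
have z2 : mu2 != 0 by rewrite gt_eqF.
rewrite !belykh_gauge_le (adapted_coord_belykh p z1 n1 e1).
rewrite (adapted_coord_belykh p z2 n2 e2).
have := fst_adapted_coord p n1 n2; rewrite /belykh_eigen in e1.
have key : mu1 * (mu1 - mu2) <= 2 * (mu1 - lambda) by nra.
move: (adapted_coord mu1 p) (adapted_coord mu2 p) (p 0 0) => u s x xE.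
move=> /andP[/andP[u1 u2] /andP[s1 s2]].
have expand w : (mu1 - lambda) * w <= mu1 - mu2 -> mu1 * w <= 2.
  move=> wle; rewrite -(@ler_pM2l _ (mu1 - lambda)); last by lra.
  nra.
case: (ltrP x 0) => x0.
  have ? := expand (1 + u) ltac:(nra).
  by apply/andP; split; apply/andP; split; nra.
have ? := expand (1 - u) ltac:(nra).
by apply/andP; split; apply/andP; split; nra.
Qed.
End BelykhMap.

(** * The singular hyperbolic attractor *)

Theorem theorem5 (R : realType) (lambda a : R)
    (lambda_gt0 : 0 < lambda) (lambda_lt1 : lambda < 1) (a_gt0 : 0 < a)
    (a_le : a <= 1 - lambda) :
  has_singular_hyperbolic_attractor (belykh a lambda) (vertical_axis (R:=R))
    (belykh_matrix a lambda).
Proof.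
have [mu1 [mu2 [e1 e2 m12 m1 m2]]] := belykh_eigenvalues lambda_gt0 lambda_lt1 a_gt0.
pose v mu : 'cV[R]_2 := \col_(i < 2) if i == 0 then 1 else mu - 1 - a.
exists [set p | belykh_gauge lambda mu1 mu2 p <= 1], (v mu1), (v mu2), mu1, mu2.
have v0 mu : v mu != 0.
  by apply/eqP => /colP /(_ 0); rewrite !mxE /= => /eqP; rewrite oner_eq0.
have Av1 := belykh_eigenvector e1; have Av2 := belykh_eigenvector e2.
split.
- split; first exact: region_belykh_gauge_ball.
  + by apply: bounded_belykh_gauge_ball => //; lra.
  + move=> _ [p Pp <-]; exact: belykh_gauge_ball_invariant.
  + (* The vertex (1, 0) of the parallelogram is a fixed point. *)
    exists (delta_mx 0 0) => k _; exists (delta_mx 0 0).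
      by rewrite /= belykh_gauge_le /adapted_coord !mxE /= mul0r addr0 lexx; lra.
    elim: k => [//|k IH]; rewrite iterS IH.
    apply/colP => i; rewrite !mxE /= /belykh_g ltr10.
    by case: (i == 0) => /=; ring.
- split=> [p|p Sp|p Sp w]; first exact: belykh_discontinuous.
  + by have := is_diff_belykh a lambda Sp => -[].
  + by have dfp := is_diff_belykh a lambda Sp; rewrite diff_val.
- split=> //; last by lra.
  by apply: rank_row_mx2; rewrite !mxE /= !mul1r; lra.
- move=> p _ offS; have df := is_diff_iter_belykh offS.
  split; apply: lyapunov_exponent_eigenvector df _ _ _ => //; lra.
Qed.
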